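(* Let $A$ be a Malcev algebra over a field of characteristic $\ne 2$. Then $A$ satisfies the identity $h(a,b,c,d,e)\equiv 0$ if and only if $A$ satisfies the identity $k(a,b,c,d,e)\equiv 0$, where, writing the product as juxtaposition, $$\begin{aligned} h(a,b,c,d,e)={}&(((ab)c)d)e+(((ab)c)e)d-(((ab)d)c)e-(((ab)e)c)d\\ &+(((ad)b)e)c-(((ad)e)b)c+(((ae)b)d)c-(((ae)d)b)c\\ &+2((ab)(cd))e+2((ab)(ce))d+2((ad)(be))c+2((ae)(bd))c \end{aligned}$$ and $$\begin{aligned} k(a,b,c,d,e)={}&-(((ab)c)e)d+(((ab)e)d)c+(((ac)b)d)e-(((ac)d)e)b\\ &-(((ad)b)c)e-(((ad)c)b)e+(((ae)b)c)d+(((ae)c)b)d\\ &+(((bd)c)a)e-(((be)a)d)c+(((be)c)d)a-(((be)d)a)c\\ &+(((cd)a)e)b-(((cd)b)e)a+(((cd)e)a)b-(((ce)b)a)d\\ &+((ab)c)(de)+((ac)b)(de). \end{aligned}$$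
   Context: A Malcev algebra is a vector space with a bilinear product $[a,b]$ (written $ab$ in the claim) satisfying $[a,b]+[b,a]\equiv 0$ and $[[[a,c],b],d]+[[[d,a],c],b]+[[[c,b],d],a]+[[[b,d],a],c]-[[a,b],[c,d]]\equiv 0$. The polynomial $h$ is the Filippov $h$-polynomial; $k$ is called the 18-term identity. An algebra satisfies an identity $f\equiv 0$ if $f$ vanishes for all substitutions of elements of the algebra for the variables. *)

(* Defs.v *)
From HB Require Import structures.
From mathcomp Require Import all_boot all_order all_algebra.

Set Implicit Arguments.
Unset Strict Implicit.
Unset Printing Implicit Defensive.

Import GRing.Theory.
Local Open Scope ring_scope.

Section Identities.

Variables (V : zmodType) (mul : V -> V -> V).

Local Notation "x · y" := (mul x y) (at level 40, left associativity).

Record is_malcev : Prop := IsMalcev {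
  malcev_anticommutative : forall a b : V, a · b + b · a = 0;
  malcev_identity : forall a b c d : V,
    ((a · c) · b) · d + ((d · a) · c) · b + ((c · b) · d) · a
      + ((b · d) · a) · c - (a · b) · (c · d) = 0
}.

Definition filippov_h (a b c d e : V) : V :=
    (((a · b) · c) · d) · e + (((a · b) · c) · e) · d
  - (((a · b) · d) · c) · e - (((a · b) · e) · c) · d
  + (((a · d) · b) · e) · c - (((a · d) · e) · b) · c
  + (((a · e) · b) · d) · c - (((a · e) · d) · b) · c
  + (((a · b) · (c · d)) · e) *+ 2 + (((a · b) · (c · e)) · d) *+ 2
  + (((a · d) · (b · e)) · c) *+ 2 + (((a · e) · (b · d)) · c) *+ 2.

Definition eighteen_term_k (a b c d e : V) : V :=
  - ((((a · b) · c) · e) · d) + (((a · b) · e) · d) · c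
  + (((a · c) · b) · d) · e - (((a · c) · d) · e) · b
  - (((a · d) · b) · c) · e - (((a · d) · c) · b) · e
  + (((a · e) · b) · c) · d + (((a · e) · c) · b) · d
  + (((b · d) · c) · a) · e - (((b · e) · a) · d) · c
  + (((b · e) · c) · d) · a - (((b · e) · d) · a) · c
  + (((c · d) · a) · e) · b - (((c · d) · b) · e) · a
  + (((c · d) · e) · a) · b - (((c · e) · b) · a) · d
  + ((a · b) · c) · (d · e) + ((a · c) · b) · (d · e).

End Identities.

(* Main.v *)
Require Import Defs.
From HB Require Import structures.
From mathcomp Require Import all_boot all_order all_algebra.

Import GRing.Theory.
Local Open Scope ring_scope.

(** Write [m a b c d] for the left-hand side of the Malcev identity.  The two
    polynomials are tied together by three relations, each of which holds in
    every anticommutative algebra up to a combination of values of [m] and of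
    products of such values with an element, called corrections below:

    - [k a c b e d = - k a b c d e], with no correction at all
      ([eighteen_term_k_swap]);
    - [k d c b a e = - k a b c d e], up to eight corrections
      ([eighteen_term_k_reflect_defect]);
    - [h a b e c d = k a b c d e + k a b d c e], up to twelve corrections
      ([filippov_h_defect]).

    In a Malcev algebra the third relation says that [h] is the symmetrization
    of [k] in its third and fourth arguments, so [k = 0] implies [h = 0].
    Conversely, if [h = 0] then the transposition of these two arguments
    changes the sign of [k].  By the first two relations, so do the
    permutations (2 3)(4 5) and (1 4)(2 3) of the arguments.  These three
    permutations generate the symmetric group on five letters, which therefore
    acts on [k] through a sign character.  The only such character that is -1
    on a transposition is the signature, and it is +1 on the even permutation
    (2 3)(4 5).  Hence [k = - k], that is [2 k = 0], and [k = 0] because 2 is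
    invertible ([eighteen_term_k_mulr2n_eq0]).

    The three relations were obtained by solving linear systems in the space
    of multilinear anticommutative polynomials of degree five, whose basis
    consists of 105 monomials.  Once the corrections are known,
    each relation is a formal consequence of biadditivity and
    anticommutativity: expand both sides into signed monomials, put each
    monomial into a standard form by exchanging factors, and observe that
    equal monomials cancel.  This computation is done by reflection
    ([cancels_sound]). *)

(** * Cancellation of signed monomials in anticommutative products *)

Inductive monomial := Gen of nat | Prod of monomial & monomial.

Fixpoint monomial_eqb (s t : monomial) : bool :=
  match s, t with
  | Gen i, Gen j => i == j
  | Prod s1 s2, Prod t1 t2 => monomial_eqb s1 t1 && monomial_eqb s2 t2
  | _, _ => false
  end.

Lemma monomial_eqP : Equality.axiom monomial_eqb.
Proof.
elim=> [i|s1 IH1 s2 IH2] [j|t1 t2] /=; try by constructor.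
- by apply: (iffP eqP) => [->|[]].
- apply: (iffP andP) => [[/IH1 -> /IH2 ->] //|[<- <-]].
  by split; [apply/IH1|apply/IH2].
Qed.

HB.instance Definition _ := hasDecEq.Build monomial monomial_eqP.

(** The standard form of a product of two distinct monomials has the larger
    factor on the left. *)
Fixpoint monomial_lt (s t : monomial) : bool :=
  match s, t with
  | Gen i, Gen j => (i < j)%N
  | Gen _, Prod _ _ => true
  | Prod _ _, Gen _ => false
  | Prod s1 s2, Prod t1 t2 =>
      monomial_lt s1 t1 || (s1 == t1) && monomial_lt s2 t2
  end.

(** The boolean is [true] for a minus sign. *)
Definition signed := (bool * monomial)%type.

Definition signed_prod (p q : signed) : signed :=
  if monomial_lt p.2 q.2 then (~~ (p.1 (+) q.1), Prod q.2 p.2)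
  else (p.1 (+) q.1, Prod p.2 q.2).

Inductive expr :=
  | Var of nat | Add of expr & expr | Opp of expr | Mul of expr & expr.

Fixpoint expand (u : expr) : seq signed :=
  match u with
  | Var i => [:: (false, Gen i)]
  | Add u v => expand u ++ expand v
  | Opp u => [seq (~~ p.1, p.2) | p <- expand u]
  | Mul u v => [seq signed_prod p q | p <- expand u, q <- expand v]
  end.

Definition cancels (s : seq signed) : bool :=
  perm_eq [seq p.2 | p <- s & p.1] [seq p.2 | p <- s & ~~ p.1].

Section AnticommutativeProduct.

Variables (V : zmodType) (mul : V -> V -> V).
Hypothesis mulDl : left_distributive mul +%R.
Hypothesis mulDr : right_distributive mul +%R.
Hypothesis mulC : forall a b : V, mul a b + mul b a = 0.

Let mul0l b : mul 0 b = 0.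
Proof. by apply: (addrI (mul 0 b)); rewrite -mulDl !addr0. Qed.

Let mul0r a : mul a 0 = 0.
Proof. by apply: (addrI (mul a 0)); rewrite -mulDr !addr0. Qed.

Let mulNl a b : mul (- a) b = - mul a b.
Proof. by apply: (addrI (mul a b)); rewrite -mulDl !subrr mul0l. Qed.

Let mulNr a b : mul a (- b) = - mul a b.
Proof. by apply: (addrI (mul a b)); rewrite -mulDr !subrr mul0r. Qed.

Let mulNC a b : mul a b = - mul b a.
Proof. by apply/eqP; rewrite -addr_eq0 mulC. Qed.

Variable env : seq V.

Fixpoint monomial_eval (t : monomial) : V :=
  match t with
  | Gen i => env`_i
  | Prod s t => mul (monomial_eval s) (monomial_eval t)
  end.

Definition signed_eval (p : signed) : V :=
  if p.1 then - monomial_eval p.2 else monomial_eval p.2.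

Fixpoint eval (u : expr) : V :=
  match u with
  | Var i => env`_i
  | Add u v => eval u + eval v
  | Opp u => - eval u
  | Mul u v => mul (eval u) (eval v)
  end.

Lemma signed_eval_prod p q :
  signed_eval (signed_prod p q) = mul (signed_eval p) (signed_eval q).
Proof.
case: p q => [sp s] [sq t]; rewrite /signed_prod /signed_eval /=.
case: (monomial_lt s t) => /=; last first.
  by case: sp; case: sq; rewrite ?mulNl ?mulNr ?opprK.
rewrite (mulNC (monomial_eval t)).
by case: sp; case: sq; rewrite ?mulNl ?mulNr ?opprK.
Qed.

Lemma eval_expand u : eval u = \sum_(p <- expand u) signed_eval p.
Proof.
elim: u => [i|u IHu v IHv|u IHu|u IHu v IHv] /=.
- by rewrite big_seq1.
- by rewrite big_cat IHu IHv.
- rewrite IHu big_map -sumrN; apply: eq_bigr => -[[] t] _ //=.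
  by rewrite /signed_eval opprK.
- rewrite IHu IHv big_allpairs_dep.
  rewrite (big_morph (mul^~ _) (fun x y => mulDl x y _) (mul0l _)).
  apply: eq_bigr => p _; rewrite (big_morph _ (mulDr _) (mul0r _)).
  by apply: eq_bigr => q _; rewrite signed_eval_prod.
Qed.

Lemma cancels_sound u : cancels (expand u) -> eval u = 0.
Proof.
rewrite eval_expand (bigID (fun p : signed => p.1)) /= => eq_u.
rewrite -[X in X + _]big_filter -[X in _ + X]big_filter.
have -> : \sum_(p <- [seq p <- expand u | p.1]) signed_eval p
    = - \sum_(t <- [seq p.2 | p <- expand u & p.1]) monomial_eval t.
  rewrite big_map -sumrN !big_filter.
  by apply: eq_bigr => p; rewrite /signed_eval => ->.
have -> : \sum_(p <- [seq p <- expand u | ~~ p.1]) signed_eval p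
    = \sum_(t <- [seq p.2 | p <- expand u & ~~ p.1]) monomial_eval t.
  rewrite big_map !big_filter.
  by apply: eq_bigr => p; rewrite /signed_eval => /negbTE ->.
by rewrite (perm_big _ eq_u) addNr.
Qed.

End AnticommutativeProduct.

(** * Relations between the two polynomials *)

Definition malcev_defect {V : zmodType} (mul : V -> V -> V) (a b c d : V) : V :=
  mul (mul (mul a c) b) d + mul (mul (mul d a) c) b
    + mul (mul (mul c b) d) a + mul (mul (mul b d) a) c
    - mul (mul a b) (mul c d).

Ltac reify mul env t :=
  lazymatch t with
  | GRing.add ?x ?y =>
      let u := reify mul env x in let v := reify mul env y in
      constr:(Add u v)
  | GRing.opp ?x => let u := reify mul env x in constr:(Opp u)
  | mul ?x ?y =>
      let u := reify mul env x in let v := reify mul env y in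
      constr:(Mul u v)
  | ?x => let rec find env :=
            lazymatch env with
            | x :: _ => constr:(0%N)
            | _ :: ?env' => let i := find env' in constr:(i.+1)
            end in
          let i := find env in constr:(Var i)
  end.

Ltac expand_and_cancel sound mul env :=
  apply/eqP; rewrite -subr_eq0; apply/eqP;
  rewrite /filippov_h /eighteen_term_k /malcev_defect ?mulr2n;
  lazymatch goal with |- ?t = _ =>
    let u := reify mul env t in
    apply: (sound env u); vm_compute; reflexivity
  end.

Section Relations.

Variables (V : zmodType) (mul : V -> V -> V).
Hypothesis mulDl : left_distributive mul +%R.
Hypothesis mulDr : right_distributive mul +%R.
Hypothesis mulC : forall a b : V, mul a b + mul b a = 0.

Local Notation "x · y" := (mul x y) (at level 40, left associativity).
Local Notation h := (filippov_h mul).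
Local Notation k := (eighteen_term_k mul).
Local Notation m := (malcev_defect mul).
Let sound := @cancels_sound V mul mulDl mulDr mulC.

Lemma eighteen_term_k_swap a b c d e : k a c b e d = - k a b c d e.
Proof. expand_and_cancel sound mul [:: a; b; c; d; e]. Qed.

(** Unlike [eighteen_term_k_swap], this symmetry of [k] fails in the free
    anticommutative algebra.  A second sign rule is what makes the converse
    implication work: the permutations (3 4) and (2 3)(4 5) fix the first
    argument, so they alone do not generate the symmetric group. *)
Lemma eighteen_term_k_reflect_defect a b c d e :
  k d c b a e = - k a b c d e
    + (m a b e d · c + m a c e d · b + m a e d b · c + m a e d c · b)
    - (m b c (a · e) d + m b c d (a · e) + m (d · e) a b c + m a (d · e) b c).
Proof. expand_and_cancel sound mul [:: a; b; c; d; e]. Qed.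

Definition symmetrization_defect a b c d e : V :=
  m (a · b) c d e - m b (a · c) d e - m a c (b · e) d
    - m a b e c · d - m a c e b · d - m a c b d · e.

(** Both sides are symmetric in [c] and [d], and the twelve correction terms
    can be chosen to be exchanged in pairs by this symmetry. *)
Lemma filippov_h_defect a b c d e :
  h a b e c d = k a b c d e + k a b d c e
    + symmetrization_defect a b c d e + symmetrization_defect a b d c e.
Proof.
rewrite /symmetrization_defect.
expand_and_cancel sound mul [:: a; b; c; d; e].
Qed.

Hypothesis malcev : forall a b c d : V, m a b c d = 0.

Let mul0l b : mul 0 b = 0.
Proof. by apply: (addrI (mul 0 b)); rewrite -mulDl !addr0. Qed.

Lemma eighteen_term_k_reflect a b c d e : k d c b a e = - k a b c d e.
Proof.
by rewrite eighteen_term_k_reflect_defect !malcev !mul0l !addr0 subr0.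
Qed.

Lemma filippov_h_symmetrization a b c d e :
  h a b e c d = k a b c d e + k a b d c e.
Proof.
by rewrite filippov_h_defect /symmetrization_defect !malcev !mul0l !subr0 !addr0.
Qed.

(** The even permutation (2 3)(4 5) changes the sign of [k] by
    [eighteen_term_k_swap], and preserves it when [h] vanishes, being then a
    product of an even number of sign-changing transpositions. *)
Lemma eighteen_term_k_mulr2n_eq0 :
  (forall a b c d e, h a b c d e = 0) -> forall a b c d e, k a b c d e *+ 2 = 0.
Proof.
move=> h0 a b c d e.
have swap34 x y z t w : k x y t z w = - k x y z t w.
  by apply/eqP; rewrite -addr_eq0 -filippov_h_symmetrization h0.
(* (2 5) is the conjugate of (3 4) by (2 3)(4 5). *)
have swap25 x y z t w : k x w z t y = - k x y z t w.
  by rewrite eighteen_term_k_swap swap34 eighteen_term_k_swap opprK.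
(* (3 5) is the conjugate of (2 5) by (1 4)(2 3). *)
have swap35 x y z t w : k x y w t z = - k x y z t w.
  by rewrite eighteen_term_k_reflect swap25 eighteen_term_k_reflect opprK.
(* (2 3) = (2 5)(3 5)(2 5) and (4 5) = (3 4)(3 5)(3 4). *)
have even : k a c b e d = k a b c d e.
  by rewrite swap25 swap35 swap25 swap34 swap35 swap34 !opprK.
by rewrite mulr2n -{1}even eighteen_term_k_swap addNr.
Qed.

End Relations.

(** * Equivalence of the two identities *)

Theorem lemma4p4 (F : fieldType) (hF : 2%N \notin [pchar F])
    (A : lmodType F) (mul : {bilinear A -> A -> A}) (hA : is_malcev mul) :
  (forall a b c d e : A, filippov_h mul a b c d e = 0) <->
  (forall a b c d e : A, eighteen_term_k mul a b c d e = 0).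
Proof.
have [mulC malcev] := hA.
have mulDl : left_distributive mul +%R by move=> a b c; exact: linearDl.
have mulDr : right_distributive mul +%R by move=> a b c; exact: linearDr.
split=> [h0 a b c d e|k0 a b c d e]; last first.
  by rewrite (filippov_h_symmetrization _ _ mulDl mulDr mulC malcev) !k0 addr0.
have := eighteen_term_k_mulr2n_eq0 _ _ mulDl mulDr mulC malcev h0 a b c d e.
have two_neq0 : 2%:R != 0 :> F by move: hF; rewrite inE.
by move/eqP; rewrite -scaler_nat scaler_eq0 (negbTE two_neq0) => /eqP.
Qed.
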